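(* Let $f\in C^{1,1}_L(\mathbb{R}^n)$, let $\mathcal{Y}=\{y_1,\dots,y_{n+1}\}\subset\mathbb{R}^n$ be affinely independent, let $m$ be the affine function interpolating $f$ on $\mathcal{Y}$, and let $y_0\in\mathbb{R}^n$. Let $G$, $H^\star$ and $\{\mu_{ij}\}_{i\in\mathcal{I}_+,j\in\mathcal{I}_-}$ be as in the context. If $\mu_{ij}\ge0$ for all $(i,j)\in\mathcal{I}_+\times\mathcal{I}_-$, then $$|m(y_0)-f(y_0)|\le\tfrac12\langle G,H^\star\rangle .$$
   Context: Let $n\ge1$, $L>0$. $C^{1,1}_L(\mathbb{R}^n)$ denotes the set of differentiable $f:\mathbb{R}^n\to\mathbb{R}$ with $\|\nabla f(u_1)-\nabla f(u_2)\|\le L\|u_1-u_2\|$ for all $u_1,u_2$. $m$ is the unique affine function with $m(y_i)=f(y_i)$, $i=1,\dots,n+1$. The barycentric coordinates of $y_0$ w.r.t. $\mathcal{Y}$ are the unique reals $\ell_1,\dots,\ell_{n+1}$ with $\sum_{i=1}^{n+1}\ell_i=1$, $\sum_{i=1}^{n+1}\ell_iy_i=y_0$; set $\ell_0=-1$. The points are ordered so that $\ell_1\ge\cdots\ge\ell_{n+1}$. Let $\mathcal{I}_+=\{i\in\{0,\dots,n+1\}:\ell_i>0\}=\{1,\dots,|\mathcal{I}_+|\}$, $\mathcal{I}_-=\{i\in\{0,\dots,n+1\}:\ell_i<0\}=\{0\}\cup\{n+3-|\mathcal{I}_-|,\dots,n+1\}$. Let $G=\sum_{i=0}^{n+1}\ell_iy_iy_i^T$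 with eigendecomposition $G=P\Lambda P^T$ ($P$ orthogonal, $\Lambda$ diagonal); let $P_+$ (resp. $P_-$) be the matrix of columns of $P$ belonging to positive (resp. negative) eigenvalues ($G$ has $|\mathcal{I}_+|-1$ positive and $|\mathcal{I}_-|-1$ negative eigenvalues), and $H^\star=L\,P\,\mathrm{sign}(\Lambda)P^T=L(P_+P_+^T-P_-P_-^T)$ (entrywise sign, $\mathrm{sign}(0)=0$). Let $Y\in\mathbb{R}^{(n+1)\times n}$ have $i$th row $(y_i-y_0)^T$; $Y_+$ consists of its first $|\mathcal{I}_+|$ rows, $Y_-$ of its last $|\mathcal{I}_-|-1$ rows; $\ell_+=(\ell_1,\dots,\ell_{|\mathcal{I}_+|})^T$. $Y_-P_-$ is invertible; set $M=\operatorname{diag}(\ell_+)Y_+P_-(Y_-P_-)^{-1}$, $\mu_{ij}=[M]_{i,(j-n-2+|\mathcal{I}_-|)}$ for $(i,j)\in\mathcal{I}_+\times(\mathcal{I}_-\setminus\{0\})$, and $\mu_{i0}=\ell_i-\sum_{j\in\mathcal{I}_-\setminus\{0\}}\mu_{ij}$ for $i\in\mathcal{I}_+$. For matrices, $\langle A,B\rangle=\sum_{i,j}A_{ij}B_{ij}$. *)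

(* Defs.v *)
From HB Require Import structures.
From mathcomp Require Import all_boot all_order all_algebra.
From mathcomp Require Import all_classical all_reals all_analysis.
Set Implicit Arguments. Unset Strict Implicit. Unset Printing Implicit Defensive.
Import Order.TTheory GRing.Theory Num.Theory.
Import numFieldNormedType.Exports.
Local Open Scope ring_scope.

(* Points of R^n are row vectors 'rV[R]_n.  The paper's points y_1..y_{n+1}
   are y 0 .. y n (shift by one), y_0 is a separate vector y0. *)

Section Defs.
Variable R : realType.

Definition enorm (n : nat) (v : 'rV[R]_n) : R := Num.sqrt (\sum_i v 0 i ^+ 2).

Definition grad (n : nat) (f : 'rV[R]_n -> R) (x : 'rV[R]_n) : 'rV[R]_n :=
  \row_j derive f x (delta_mx 0 j).

Definition C11 (n : nat) (L : R) (f : 'rV[R]_n -> R) : Prop :=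
  (forall x, differentiable f x) /\
  (forall u1 u2, enorm (grad f u1 - grad f u2) <= L * enorm (u1 - u2)).

Definition aff_indep (n k : nat) (y : 'I_k -> 'rV[R]_n) : Prop :=
  forall c : 'I_k -> R, \sum_i c i = 0 -> \sum_i c i *: y i = 0 ->
    forall i, c i = 0.

Definition is_affine (n : nat) (m : 'rV[R]_n -> R) : Prop :=
  exists (a : 'rV[R]_n) (b : R), forall x, m x = \sum_i a 0 i * x 0 i + b.

Definition frob (n : nat) (A B : 'M[R]_n) : R := \sum_i \sum_j A i j * B i j.

(* G = sum_{i=0}^{n+1} l_i y_i y_i^T with l_0 = -1 *)
Definition Gmat (n : nat) (y0 : 'rV[R]_n) (y : 'I_n.+1 -> 'rV[R]_n)
    (l : 'I_n.+1 -> R) : 'M[R]_n :=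
  \sum_i l i *: ((y i)^T *m y i) - (y0^T *m y0).

Definition Hstar (n : nat) (L : R) (P Lam : 'M[R]_n) : 'M[R]_n :=
  L *: (P *m map_mx (fun x => Num.sg x) Lam *m P^T).

(* |I_+| and |I_-| - 1 *)
Definition npos (n : nat) (l : 'I_n.+1 -> R) : nat := #|[set i | 0 < l i]|.
Definition nneg (n : nat) (l : 'I_n.+1 -> R) : nat := #|[set i | l i < 0]|.

Definition Ymat (n : nat) (y0 : 'rV[R]_n) (y : 'I_n.+1 -> 'rV[R]_n)
  : 'M[R]_(n.+1, n) := \matrix_(i, j) (y i - y0) 0 j.

Definition Yplus (n : nat) (y0 : 'rV[R]_n) (y : 'I_n.+1 -> 'rV[R]_n)
    (l : 'I_n.+1 -> R) : 'M[R]_(npos l, n) :=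
  \matrix_(i < npos l, j < n) Ymat y0 y (inord i) j.

Definition Yminus (n : nat) (y0 : 'rV[R]_n) (y : 'I_n.+1 -> 'rV[R]_n)
    (l : 'I_n.+1 -> R) : 'M[R]_(nneg l, n) :=
  \matrix_(r < nneg l, j < n) Ymat y0 y (inord (n.+1 - nneg l + r)) j.

Definition Mmat (n : nat) (y0 : 'rV[R]_n) (y : 'I_n.+1 -> 'rV[R]_n)
    (l : 'I_n.+1 -> R) (Pm : 'M[R]_(n, nneg l)) : 'M[R]_(npos l, nneg l) :=
  diag_mx (\row_(i < npos l) l (inord i)) *m Yplus y0 y l *m Pm
    *m invmx (Yminus y0 y l *m Pm).

(* mu_{i0} = l_i - sum_{j in I_- \ {0}} mu_ij *)
Definition mu0 (n : nat) (y0 : 'rV[R]_n) (y : 'I_n.+1 -> 'rV[R]_n)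
    (l : 'I_n.+1 -> R) (Pm : 'M[R]_(n, nneg l)) (i : 'I_(npos l)) : R :=
  l (inord i) - \sum_k Mmat y0 y Pm i k.

End Defs.

(* Main.v *)
(* The weights [mu_ij] are a transport plan from the points of [I_+] to those of [I_-]
   (row sums [l_i], column sums [- l_j]), so the error is [sum mu_ij (f y_i - f y_j)].
   Let [Q = P_- P_-^T] and [d = y_i - y_j].  The descent lemma from [y_i] and from [y_j] to
   the common point [y_i - d Q = y_j + d (1 - Q)] bounds [f y_i - f y_j] by
   [<g_i + L y_i, d Q> + <g_j - L y_j, d (1 - Q)> + L/2 (phi y_i - phi y_j)], where [g] is the
   gradient and [phi x = <x, x (1 - 2 Q)>].  The definition of [M] makes
   [sum_j mu_ij d Q] vanish for every [i], and since [G] commutes with [Q] it also makes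
   [sum_i mu_ij d (1 - Q)] vanish for every [j].  What is left is
   [L/2 <G, 1 - 2 Q> = 1/2 <G, H*>], as [1 - 2 Q] and [sign G] agree on the range of [G].
   The lower bound is the same argument for [- f]. *)
Require Import Defs.
From HB Require Import structures.
From mathcomp Require Import all_boot all_order all_algebra.
From mathcomp Require Import all_classical all_reals all_analysis.
From mathcomp Require Import ring lra zify.
Set Implicit Arguments. Unset Strict Implicit. Unset Printing Implicit Defensive.
Import Order.TTheory GRing.Theory Num.Theory.
Import numFieldNormedType.Exports.
Local Open Scope ring_scope.

(** * The Euclidean inner product and the Cauchy-Schwarz inequality *)

Section InnerProduct.
Variables (R : realType) (n : nat).
Implicit Types (u v w : 'rV[R]_n) (A : 'M[R]_n).

Definition dot u v : R := (u *m v^T) 0 0.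

Lemma dotE u v : dot u v = \sum_i u 0 i * v 0 i.
Proof. by rewrite /dot mxE; apply: eq_bigr => i _; rewrite mxE. Qed.

Lemma dotC u v : dot u v = dot v u.
Proof. by rewrite !dotE; apply: eq_bigr => i _; rewrite mulrC. Qed.

Lemma dotDl u v w : dot (u + v) w = dot u w + dot v w.
Proof. by rewrite /dot mulmxDl mxE. Qed.

Lemma dotNl u w : dot (- u) w = - dot u w.
Proof. by rewrite /dot mulNmx mxE. Qed.

Lemma dotZl a u w : dot (a *: u) w = a * dot u w.
Proof. by rewrite /dot -scalemxAl mxE. Qed.

Lemma dot0r u : dot u 0 = 0.
Proof. by rewrite /dot trmx0 mulmx0 mxE. Qed.

Lemma dotDr u v w : dot w (u + v) = dot w u + dot w v.
Proof. by rewrite dotC dotDl !(dotC w). Qed.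

Lemma dotNr u w : dot w (- u) = - dot w u.
Proof. by rewrite dotC dotNl (dotC w). Qed.

Lemma dotZr a u w : dot w (a *: u) = a * dot w u.
Proof. by rewrite dotC dotZl (dotC w). Qed.

Lemma dot_sumr (I : Type) (r : seq I) (F : I -> 'rV[R]_n) u :
  dot u (\sum_(i <- r) F i) = \sum_(i <- r) dot u (F i).
Proof. exact: (big_morph (dot u) (fun a b => dotDr a b u) (dot0r u)). Qed.

Lemma dot_mulmxl u A v : dot (u *m A) v = dot u (v *m A^T).
Proof. by rewrite /dot trmx_mul trmxK mulmxA. Qed.

Lemma dot_ge0 u : 0 <= dot u u.
Proof. by rewrite dotE; apply: sumr_ge0 => i _; rewrite -expr2 sqr_ge0. Qed.

Lemma enormE u : enorm u = Num.sqrt (dot u u).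
Proof. by rewrite dotE. Qed.

Lemma sqr_enorm u : enorm u ^+ 2 = dot u u.
Proof. by rewrite enormE sqr_sqrtr ?dot_ge0. Qed.

Lemma enorm_ge0 u : 0 <= enorm u.
Proof. exact: sqrtr_ge0. Qed.

Lemma enormN u : enorm (- u) = enorm u.
Proof. by rewrite !enormE dotNl dotNr opprK. Qed.

Lemma enormZ a u : 0 <= a -> enorm (a *: u) = a * enorm u.
Proof.
by move=> a0; rewrite !enormE dotZl dotZr mulrA sqrtrM ?mulr_ge0// -expr2
  sqrtr_sqr ger0_norm.
Qed.

(** With [a] and [b] the norms of [u] and [v], the square of the norm of [b u - a v] expands to
    [2 a b (a b - <u, v>)]; positivity settles the case [a b > 0]. *)
Lemma dot_le_enorm u v : dot u v <= enorm u * enorm v.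
Proof.
set a := enorm u; set b := enorm v.
have a0 : 0 <= a := enorm_ge0 u.
have b0 : 0 <= b := enorm_ge0 v.
have key : 0 <= 2 * (a * b) * (a * b - dot u v).
  have -> : 2 * (a * b) * (a * b - dot u v) = dot (b *: u - a *: v) (b *: u - a *: v).
    rewrite !(dotDl, dotDr, dotNl, dotNr, dotZl, dotZr) -!sqr_enorm (dotC v u).
    by rewrite -/a -/b; ring.
  exact: dot_ge0.
have [ab0|ab0] := ltP 0 (a * b).
  by rewrite -subr_ge0; rewrite pmulr_rge0 in key => //; rewrite mulr_gt0.
have {ab0 key} /eqP : a * b = 0 by apply/le_anti; rewrite ab0 mulr_ge0.
(* If [a b = 0], one vector has norm zero, so all its coordinates vanish and both sides are zero. *)
have dot0 (s t : 'rV[R]_n) : enorm s = 0 -> dot s t = 0.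
  move=> s0; have := sqr_enorm s; rewrite s0 expr0n /= !dotE => /esym/eqP.
  rewrite psumr_eq0 => [/allP h|i _]; last by rewrite -expr2 sqr_ge0.
  rewrite big1 // => i _; have := h i (mem_index_enum i).
  by rewrite /= mulf_eq0 orbb => /eqP->; rewrite mul0r.
by rewrite mulf_eq0 => /orP[] /eqP h;
  rewrite ?(dot0 _ _ h) ?(dotC u v) ?(dot0 _ _ h) h ?mulr0 ?mul0r.
Qed.

End InnerProduct.

(** * Gradients along segments and the descent lemma *)

Section Descent.
Variables (R : realType) (n : nat).
Implicit Types (f : 'rV[R]_n -> R) (x d v : 'rV[R]_n) (L : R).

Lemma derive_grad f x v : differentiable f x -> 'D_v f x = dot (grad f x) v.
Proof.
move=> fx; rewrite deriveE // [in LHS](row_sum_delta v) linear_sum /= dotE.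
by apply: eq_bigr => i _; rewrite linearZ /= -deriveE // mxE mulrC.
Qed.

Lemma is_derive_segment f x d (t : R) : differentiable f (x + t *: d) ->
  is_derive t 1 (fun s : R => f (x + s *: d)) (dot (grad f (x + t *: d)) d).
Proof.
move=> fx.
(* The difference quotient of the restriction to the line is the directional difference quotient of
   [f] at [x + t d]. *)
have E : (fun h : R => h^-1 *: (((fun s : R => f (x + s *: d)) \o shift t) (h *: 1)
    - f (x + t *: d)))
  = (fun h : R => h^-1 *: ((f \o shift (x + t *: d)) (h *: d) - f (x + t *: d))).
  apply/funext => h /=; congr (_ *: (f _ - _)).
  by rewrite scalerDl /GRing.scale /= mulr1 addrCA addrA.
apply: DeriveDef; first by rewrite /derivable E; exact: diff_derivable.
by rewrite /derive E -derive_grad.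
Qed.

Lemma gradN f x : differentiable f x -> grad (fun u => - f u) x = - grad f x.
Proof. by move=> fx; apply/rowP => j; rewrite !mxE deriveN //; exact: diff_derivable. Qed.

Lemma C11N L f : C11 L f -> C11 L (fun x => - f x).
Proof.
move=> [df lf]; split=> [x|u v]; first exact: differentiableN.
by rewrite !gradN // -opprD enormN; exact: lf.
Qed.

(** Subtract from [f (x + t d)] its linear term and [t^2 L/2 <d, d>]. By Cauchy-Schwarz and the
    Lipschitz bound the difference [phi] has derivative at most 0 for [t >= 0], so the mean value
    theorem gives [phi 1 <= phi 0]. *)
Lemma descent L f x d : 0 < L -> C11 L f ->
  f (x + d) <= f x + dot (grad f x) d + L / 2 * dot d d.
Proof.
move=> L0 [df lf].
pose phi (t : R) := f (x + t *: d) - (t * dot (grad f x) d + t ^+ 2 * (L / 2 * dot d d)).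
pose dphi (t : R) := dot (grad f (x + t *: d)) d
  - (dot (grad f x) d + t * (L * dot d d)).
have dphiP (t : R) : is_derive t 1 phi (dphi t).
  have ? := @is_derive_segment f x d t (df _).
  apply: is_derive_eq; rewrite /dphi; move: (dot (grad f (x + t *: d)) d) => g.
  by rewrite /GRing.scale /=; field.
have dphi_cont : {within `[0, 1 : R], continuous phi}%classic.
  by apply: derivable_within_continuous => t _; exact: ex_derive.
have [c c01] := MVT ltr01 (fun t _ => dphiP t) dphi_cont.
rewrite /phi scale0r addr0 scale1r.
have c0 : 0 <= c by move: c01; rewrite in_itv /= => /andP[/ltW].
suff : dphi c <= 0 by lra.
rewrite /dphi opprD addrA -dotNl -dotDl subr_le0.
apply: le_trans (dot_le_enorm _ _) _.
rewrite -sqr_enorm expr2 !mulrA ler_wpM2r ?enorm_ge0 //.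
apply: le_trans (lf _ _) _.
by rewrite (addrC x) addrK enormZ // mulrA (mulrC c).
Qed.

End Descent.

(** * Bounding a difference of weighted sums by a transport plan *)

Section Transport.
Variables (R : realType) (n : nat) (L : R) (f : 'rV[R]_n -> R) (Q : 'M[R]_n).
Hypotheses (L0 : 0 < L) (fL : C11 L f) (Qsym : Q^T = Q) (Qidem : Q *m Q = Q).

Let phi (x : 'rV[R]_n) : R := dot x (x *m (1%:M - 2 *: Q)).

(* Both points are joined to [x - (x - z) Q = z + (x - z) (1 - Q)]. *)
Lemma diff_le_projections (x z : 'rV[R]_n) :
  f x - f z <= dot (grad f x + L *: x) ((x - z) *m Q)
    + dot (grad f z - L *: z) ((x - z) *m (1%:M - Q)) + L / 2 * (phi x - phi z).
Proof.
(* The descent lemma for [- f] at [x] bounds [f] at the common point from below, the one for [f] at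
   [z] bounds it from above. *)
have := descent x (- ((x - z) *m Q)) L0 (C11N fL).
have := descent z ((x - z) *m (1%:M - Q)) L0 fL.
rewrite (gradN (fL.1 x)).
have -> : z + (x - z) *m (1%:M - Q) = x - (x - z) *m Q.
  by rewrite mulmxBr mulmx1 addrA (addrC z) subrK.
set e := (_ *m (1%:M - Q)); set w := _ *m Q.
have ee : dot e e + dot w w = dot (x - z) (x - z).
  have : dot w w = dot (x - z) w by rewrite /w dot_mulmxl Qsym -mulmxA Qidem.
  rewrite /e mulmxBr mulmx1 -/w; move: (x - z) w => d w ww.
  by rewrite !(dotDl, dotDr, dotNl, dotNr) (dotC w d) ww; ring.
(* This makes the quadratic remainder separable: the cross terms are absorbed by shifting the
   gradients to [g_x + L x] and [g_z - L z], each depending on one endpoint only. *)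
have -> : L / 2 * (phi x - phi z)
   = L / 2 * (dot e e + dot w w) - L * dot x w + L * dot z e.
  rewrite ee /phi /e /w !(mulmxBr, mulmx1, mulmxBl) -!scalemxAr.
  have xz : dot z (x *m Q) = dot x (z *m Q) by rewrite dotC dot_mulmxl Qsym.
  rewrite !(dotDl, dotDr, dotNl, dotNr, dotZr) xz (dotC z x).
  by field.
rewrite !(dotDl, dotDr, dotNl, dotNr, dotZl).
move: (f _) => fw; lra.
Qed.

(** Sum the pairwise bound with weights [mu i j]. The last two hypotheses say that the displacements
    projected by [Q] average to zero for each source [i], and those projected by [1 - Q] for each
    target [j], which removes all gradients. *)
Lemma transport_le (p q : nat) (y0 : 'rV[R]_n) (A : 'M[R]_(p, n)) (C : 'M[R]_(q, n))
    (mu : 'M[R]_(p, q)) (a : 'rV[R]_p) (b : 'rV[R]_q) :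
  (forall i j, 0 <= mu i j) ->
  (forall i, \sum_j mu i j = a 0 i) -> (forall j, \sum_i mu i j = b 0 j) ->
  mu *m C *m Q = diag_mx a *m A *m Q ->
  mu^T *m A *m (1%:M - Q) = diag_mx b *m C *m (1%:M - Q) ->
  \sum_i a 0 i * f (y0 + row i A) - \sum_j b 0 j * f (y0 + row j C)
    <= L / 2 * (\sum_i a 0 i * phi (y0 + row i A) - \sum_j b 0 j * phi (y0 + row j C)).
Proof.
move=> mu0 mua mub muQ muR.
pose x i := y0 + row i A; pose z j := y0 + row j C.
have couple (h : 'rV[R]_n -> R) :
    \sum_i a 0 i * h (x i) - \sum_j b 0 j * h (z j)
    = \sum_i \sum_j mu i j * (h (x i) - h (z j)).
  under [RHS]eq_bigr do (under eq_bigr do rewrite mulrBr; rewrite sumrB -mulr_suml mua).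
  rewrite sumrB exchange_big /=; congr (_ - _); apply: eq_bigr => j _.
  by rewrite -mulr_suml mub.
have xz i j : x i - z j = row i A - row j C by rewrite /x /z opprD addrACA subrr add0r.
have rowQ i : \sum_j mu i j *: ((x i - z j) *m Q) = 0.
  have := congr1 (row i) muQ; rewrite !row_mul row_diag_mx -scalemxAl -rowE => /eqP.
  rewrite eq_sym -subr_eq0 => /eqP h; apply: etrans h; rewrite (mulmx_sum_row (row i mu)) -mua.
  rewrite scaler_suml -mulmxBl -sumrB [RHS]mulmx_suml; apply: eq_bigr => j _.
  by rewrite scalemxAl xz scalerBr mxE.
have colR j : \sum_i mu i j *: ((x i - z j) *m (1%:M - Q)) = 0.
  have := congr1 (row j) muR; rewrite !row_mul row_diag_mx -scalemxAl -rowE => /eqP.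
  rewrite -subr_eq0 => /eqP h; apply: etrans h; rewrite (mulmx_sum_row (row j mu^T)) -mub.
  rewrite scaler_suml -mulmxBl -sumrB [RHS]mulmx_suml; apply: eq_bigr => i _.
  by rewrite scalemxAl xz scalerBr !mxE.
rewrite !couple.
have : \sum_i \sum_j mu i j * (f (x i) - f (z j)) <=
   \sum_i \sum_j mu i j * (dot (grad f (x i) + L *: x i) ((x i - z j) *m Q)
    + dot (grad f (z j) - L *: z j) ((x i - z j) *m (1%:M - Q))
    + L / 2 * (phi (x i) - phi (z j))).
  apply: ler_sum => i _; apply: ler_sum => j _.
  by rewrite ler_wpM2l // diff_le_projections.
(* The weighted right-hand side is in fact equal to the target: the first gradient factor is free of
   [j] and the second of [i], so [rowQ] and [colR] apply. *)
move/le_trans; apply; rewrite le_eqVlt; apply/orP; left; apply/eqP.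
under eq_bigr do (under eq_bigr do rewrite (mulrDr _ (_ + _)) (mulrDr _ (dot _ _));
  rewrite !big_split /=).
rewrite !big_split /= big1 ?add0r => [|i _]; last first.
  under eq_bigr do rewrite -dotZr.
  by rewrite -dot_sumr rowQ dot0r.
rewrite exchange_big /= big1 ?add0r => [|j _]; last first.
  under eq_bigr do rewrite -dotZr.
  by rewrite -dot_sumr colR dot0r.
rewrite mulr_sumr; apply: eq_bigr => i _; rewrite mulr_sumr; apply: eq_bigr => j _.
by rewrite mulrCA.
Qed.

End Transport.

(** * Algebra of the weight matrix [M] *)

Section Weights.
Variables (R : realType) (n p q : nat).
Variables (A : 'M[R]_(p, n)) (B : 'M[R]_(q, n)) (a : 'rV[R]_p) (b : 'rV[R]_q).
Variable N : 'M[R]_(n, q).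

(** In the application [A], [B], [N] are [Y_+], [Y_-], [P_-]. As the rows are differences with [y0],
    the base point contributes nothing to [G]. *)
Let G := A^T *m diag_mx a *m A + B^T *m diag_mx b *m B.
Let M := diag_mx a *m A *m N *m invmx (B *m N).

Lemma dot_diag k (d u : 'rV[R]_k) :
  dot (u *m diag_mx d) u = \sum_i d 0 i * u 0 i ^+ 2.
Proof.
rewrite dotE mul_mx_diag; apply: eq_bigr => i _.
by rewrite mxE expr2 mulrAC mulrC.
Qed.

(* If [w (B N)^T = 0] then [w N^T G N w^T = w N^T A^T diag(a) A N w^T >= 0]. *)
Lemma unitmx_of_neg :
  (forall i, 0 <= a 0 i) ->
  (forall w : 'rV[R]_q, w != 0 -> dot (w *m N^T *m G *m N) w < 0) ->
  B *m N \in unitmx.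
Proof.
move=> a0 Gneg; rewrite -unitmx_tr -row_free_unit; apply: inj_row_free => w wBN.
apply/eqP/negPn/negP => /Gneg; apply/negP; rewrite -leNgt.
have -> : w *m N^T *m G *m N = w *m N^T *m A^T *m diag_mx a *m A *m N.
  by move: wBN; rewrite /G trmx_mul mulmxDr mulmxDl !mulmxA => ->; rewrite !mul0mx addr0.
have -> : dot (w *m N^T *m A^T *m diag_mx a *m A *m N) w
    = dot (w *m N^T *m A^T *m diag_mx a) (w *m N^T *m A^T).
  by rewrite /dot !trmx_mul !trmxK !mulmxA.
by rewrite dot_diag; apply: sumr_ge0 => i _; rewrite mulr_ge0 ?sqr_ge0.
Qed.

Hypothesis BNunit : B *m N \in unitmx.

Lemma weights_mulN : M *m B *m N = diag_mx a *m A *m N.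
Proof. by rewrite -mulmxA mulmxKV. Qed.

(** The all-ones row times [diag_mx a] is [a]; replacing [a A] by [- b B] lets [B N] cancel against
    its inverse. *)
Lemma weights_col_sum : a *m A + b *m B = 0 -> const_mx 1 *m M = - b.
Proof.
move=> aAbB; rewrite /M !mulmxA.
have -> : const_mx 1 *m diag_mx a = a.
  by apply/rowP => j; rewrite mul_mx_diag !mxE mul1r.
by move/eqP: aAbB; rewrite addr_eq0 => /eqP->; rewrite !mulNmx -(mulmxA b) mulmxK.
Qed.

(** Multiply by the invertible [(B N)^T]: the left side becomes [N^T A^T diag(a) A S], which is
    [- N^T B^T diag(b) B S] because [N^T G S = 0]. *)
Lemma weights_mulR k (S : 'M[R]_(n, k)) :
  N^T *m G *m S = 0 -> M^T *m A *m S = - (diag_mx b *m B *m S).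
Proof.
move=> NGS; have BNt : (B *m N)^T \in unitmx by rewrite unitmx_tr.
apply: (can_inj (mulKmx BNt)).
have -> : (B *m N)^T *m (M^T *m A *m S) = N^T *m A^T *m diag_mx a *m A *m S.
  by rewrite !mulmxA -trmx_mul mulmxKV // !trmx_mul tr_diag_mx !mulmxA.
apply/eqP; rewrite mulmxN -addr_eq0 trmx_mul !mulmxA; apply/eqP.
by rewrite -[RHS]NGS /G mulmxDr mulmxDl !mulmxA.
Qed.

End Weights.

(** * Splitting a sorted family of weights by sign *)

Section Sorted.
Variables (R : realType) (n : nat) (l : 'I_n.+1 -> R).
Hypothesis l_sorted : forall i j : 'I_n.+1, (i <= j)%N -> l j <= l i.

(** By sortedness the positive weights contain the indices up to [i] when [l i > 0] and lie strictly
    before [i] otherwise; compare cardinals. *)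
Lemma lt_npos (i : 'I_n.+1) : (i < npos l)%N = (0 < l i).
Proof.
have card_lt k : (k <= n.+1)%N -> #|[set j : 'I_n.+1 | (j < k)%N]| = k.
  move=> kn; rewrite -sum1dep_card -(big_ord_widen _ (fun=> 1%N) kn).
  by rewrite sum1_card card_ord.
apply/idP/idP => [|li]; last first.
  rewrite /npos -[i.+1](@card_lt i.+1 (ltn_ord i)).
  apply: subset_leq_card; apply/fintype.subsetP => j.
  by rewrite !inE ltnS => /l_sorted; exact: lt_le_trans.
apply: contraLR; rewrite /npos -leNgt -leqNgt => li.
rewrite -[X in (_ <= X)%N](@card_lt i (ltnW (ltn_ord i))).
apply: subset_leq_card; apply/fintype.subsetP => j; rewrite !inE ltnNge.
by apply: contraL => /l_sorted lj; rewrite -leNgt (le_trans lj).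
Qed.

End Sorted.

(** Reversing the indices and negating preserves sortedness, so facts on positive weights transfer
    to negative ones. *)
Lemma nneg_npos (R : realType) n (l : 'I_n.+1 -> R) :
  nneg l = npos (fun i => - l (rev_ord i)).
Proof.
rewrite /nneg /npos -(card_preimset _ (@rev_ord_inj n.+1)); apply: eq_card => i.
by rewrite !inE oppr_gt0.
Qed.

Lemma lt_nneg (R : realType) n (l : 'I_n.+1 -> R) (i : 'I_n.+1) :
  (forall i j : 'I_n.+1, (i <= j)%N -> l j <= l i) ->
  (n.+1 - nneg l <= i)%N = (l i < 0).
Proof.
move=> l_sorted; rewrite nneg_npos.
have := @lt_npos R n (fun i => - l (rev_ord i)) _ (rev_ord i).
rewrite rev_ordK oppr_gt0 => <- /=; last first.
  by move=> j k jk; rewrite lerN2 l_sorted //= leq_sub2l.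
have := ltn_ord i; lia.
Qed.

(** The indices form an initial positive block, a middle block of zero weights on which [F]
    vanishes, and a final negative block. *)
Lemma sum_npos_nneg (R : realType) n (l : 'I_n.+1 -> R) (V : nmodType) (F : 'I_n.+1 -> V) :
  (forall i j : 'I_n.+1, (i <= j)%N -> l j <= l i) ->
  (forall i, l i = 0 -> F i = 0) ->
  \sum_i F i = \sum_(i < npos l) F (inord i)
    + \sum_(k < nneg l) F (inord (n.+1 - nneg l + k)).
Proof.
move=> l_sorted F0.
have pn : (npos l <= n.+1)%N by rewrite -[X in (_ <= X)%N]card_ord max_card.
have qn : (nneg l <= n.+1)%N by rewrite -[X in (_ <= X)%N]card_ord max_card.
(* If the outer blocks overlapped, the first index of the negative block would have a weight of both
   signs. *)
have pq : (npos l <= n.+1 - nneg l)%N.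
  rewrite leqNgt; apply/negP => qp.
  have qn1 : (n.+1 - nneg l < n.+1)%N by apply: leq_trans qp pn.
  have := lt_npos l_sorted (Ordinal qn1); have := lt_nneg (Ordinal qn1) l_sorted.
  by rewrite /= leqnn qp => /esym l0 /esym; rewrite lt_gtF.
have -> : \sum_i F i = \sum_(0 <= k < n.+1) F (inord k).
  by rewrite big_mkord; apply: eq_bigr => i _; rewrite inord_val.
rewrite (big_cat_nat (leq0n _) pn) /= (big_cat_nat pq (leq_subr _ _)) /=.
rewrite big_mkord; congr (_ + _).
rewrite [X in X + _]big_nat_cond big1 ?add0r => [|i]; last first.
  rewrite andbT => /andP[pi iq]; have ilt : (i < n.+1)%N by lia.
  have iE : inord i = Ordinal ilt by apply: val_inj; rewrite /= inordK.
  apply: F0; apply/le_anti; rewrite iE; apply/andP; split.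
    by rewrite leNgt -(lt_npos l_sorted) /= -leqNgt.
  by rewrite leNgt -(lt_nneg _ l_sorted) /= -ltnNge.
rewrite -{1}[(n.+1 - nneg l)%N]add0n big_addn subKn // big_mkord.
by apply: eq_bigr => k _; rewrite addnC.
Qed.

(** * The one-sided bound in matrix form, with the base point included *)

Section WeightedBound.
Variables (R : realType) (n p q : nat) (L : R) (f : 'rV[R]_n -> R) (y0 : 'rV[R]_n).
Variables (A : 'M[R]_(p, n)) (B : 'M[R]_(q, n)) (a : 'rV[R]_p) (b : 'rV[R]_q).
Variable N : 'M[R]_(n, q).

Let G := A^T *m diag_mx a *m A + B^T *m diag_mx b *m B.
Let M := diag_mx a *m A *m N *m invmx (B *m N).
Let Q := N *m N^T.
Let phi (x : 'rV[R]_n) : R := dot x (x *m (1%:M - 2 *: Q)).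

(* The base point [y0], of weight [-1], becomes row 0 of [C] and column 0 of [mu]. *)
Lemma weighted_bound :
  0 < L -> C11 L f -> N^T *m N = 1%:M ->
  (forall i, 0 <= a 0 i) -> a *m A + b *m B = 0 -> \sum_i a 0 i + \sum_k b 0 k = 1 ->
  (forall w : 'rV[R]_q, w != 0 -> dot (w *m N^T *m G *m N) w < 0) ->
  N^T *m G *m (1%:M - Q) = 0 ->
  (forall i k, 0 <= M i k) -> (forall i, 0 <= a 0 i - \sum_k M i k) ->
  \sum_i a 0 i * f (y0 + row i A) + \sum_k b 0 k * f (y0 + row k B) - f y0
    <= L / 2 * (\sum_i a 0 i * phi (y0 + row i A) + \sum_k b 0 k * phi (y0 + row k B)
                - phi y0).
Proof.
move=> L0 fL NN a0 aAbB ab1 Gneg NGR M0 M00.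
have BN : B *m N \in unitmx by exact: unitmx_of_neg a0 Gneg.
pose mu := row_mx (a^T - M *m const_mx 1 : 'cV[R]_p) M.
pose C := col_mx (0 : 'rV[R]_n) B.
pose b' := row_mx (1%:M : 'M[R]_1) (- b).
have MSum i : (M *m const_mx 1 : 'cV[R]_p) i 0 = \sum_k M i k.
  by rewrite mxE; apply: eq_bigr => k _; rewrite [X in _ * X]mxE mulr1.
have Qsym : Q^T = Q by rewrite trmx_mul trmxK.
have Qidem : Q *m Q = Q by rewrite mulmxA -(mulmxA N) NN mulmx1.
have MR := weights_mulR BN NGR; rewrite -/M in MR.
have Mcol := weights_col_sum BN aAbB; rewrite -/M in Mcol.
have mu0 i j : 0 <= mu i j.
  case: (split_ordP j) => k ->; rewrite ?row_mxEl ?row_mxEr //.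
  by have := M00 i; rewrite -MSum ord1 !mxE.
have mua i : \sum_j mu i j = a 0 i.
  rewrite big_split_ord /= big_ord1 row_mxEl.
  under eq_bigr do rewrite row_mxEr.
  by rewrite -MSum !mxE subrK.
(* Column 0 sums to [sum a - sum M = sum a + sum b = 1], the opposite of the weight of [y0]. *)
have mub j : \sum_i mu i j = b' 0 j.
  suff <- : const_mx 1 *m mu = b'.
    by rewrite mxE; apply: eq_bigr => i _; rewrite [X in X * _]mxE mul1r.
  rewrite mul_mx_row mulmxBr mulmxA Mcol mulNmx opprK; congr row_mx.
  apply/rowP => k; rewrite ord1 !mxE eqxx -[RHS]ab1; congr (_ + _).
    by apply: eq_bigr => i _; rewrite !mxE mul1r.
  by apply: eq_bigr => i _; rewrite !mxE mulr1.
(* Row 0 of [C] is zero, so column 0 of [mu] drops out and [M B N = diag(a) A N] suffices. *)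
have muQ : mu *m C *m Q = diag_mx a *m A *m Q.
  by rewrite mul_row_col mulmx0 add0r /Q !mulmxA (weights_mulN A a BN).
have muR : mu^T *m A *m (1%:M - Q) = diag_mx b' *m C *m (1%:M - Q).
  rewrite tr_row_mx !mul_col_mx MR diag_mx_row mul_block_col !mul0mx !mulmx0 add0r.
  rewrite add0r mul_col_mx mul0mx; congr col_mx.
    (* The row belonging to [y0] reduces to [(a A + b B) (1 - Q)], which vanishes by the barycentric
       relation. *)
    have -> : (a^T - M *m const_mx 1)^T *m A *m (1%:M - Q)
        = a *m A *m (1%:M - Q) - const_mx 1 *m (M^T *m A *m (1%:M - Q)).
      by rewrite [(_ - _)^T]linearB /= trmxK trmx_mul trmx_const !mulmxBl !mulmxA.
    rewrite MR mulmxN opprK !mulmxA.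
    have -> : const_mx 1 *m diag_mx b = b.
      by apply/rowP => k; rewrite mul_mx_diag !mxE mul1r.
    by rewrite -mulmxDl aAbB mul0mx.
  by rewrite linearN /= !mulNmx.
have split0 (h : 'rV[R]_n -> R) :
    \sum_j b' 0 j * h (y0 + row j C) = h y0 - \sum_k b 0 k * h (y0 + row k B).
  rewrite big_split_ord /= big_ord1 row_mxEl mxE eqxx mul1r -sumrN.
  congr (h _ + _); first by rewrite rowKu linear0 addr0.
  apply: eq_bigr => k _; rewrite row_mxEr mxE mulNr; congr (- (_ * h (_ + _))).
  by rewrite rowKd.
have := transport_le L0 fL Qsym Qidem y0 mu0 mua mub muQ muR.
by rewrite (split0 f) (split0 phi) !opprB !addrA.
Qed.

End WeightedBound.

(** * Rewriting [G] and its pairing with a symmetric matrix *)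

Section Reflection.
Variables (R : realType) (n : nat).
Implicit Types (X S : 'M[R]_n).

Lemma frobE X S : frob X S = \tr (X *m S^T).
Proof.
apply: eq_bigr => i _; rewrite mxE.
by apply: eq_bigr => j _; rewrite [X in _ = _ * X]mxE.
Qed.

(** The pairing is a trace, and [tr (x^T x S) = <x, x S>] for each rank-one term. *)
Lemma frob_Gmat S (y0 : 'rV[R]_n) (y : 'I_n.+1 -> 'rV[R]_n) (l : 'I_n.+1 -> R) :
  S^T = S ->
  frob (Gmat y0 y l) S = \sum_i l i * dot (y i) (y i *m S) - dot y0 (y0 *m S).
Proof.
move=> Ssym; rewrite frobE Ssym /Gmat mulmxBl mulmx_suml linearB linear_sum /=.
have rank1 (x : 'rV[R]_n) : \tr (x^T *m x *m S) = dot x (x *m S).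
  by rewrite -mulmxA mxtrace_mulC dotC /dot trace_mx11.
rewrite rank1; congr (_ - _); apply: eq_bigr => i _.
by rewrite -scalemxAl linearZ /= rank1.
Qed.

(** On expanding, the two cross sums and the constant term each equal [y0^T y0], leaving it once
    with a minus sign. *)
Lemma Gmat_centered (y0 : 'rV[R]_n) (y : 'I_n.+1 -> 'rV[R]_n) (l : 'I_n.+1 -> R) :
  \sum_i l i = 1 -> \sum_i l i *: y i = y0 ->
  Gmat y0 y l = \sum_i l i *: ((y i - y0)^T *m (y i - y0)).
Proof.
move=> l1 ly; rewrite /Gmat.
under [RHS]eq_bigr do rewrite [(_ - _)^T]linearB /= mulmxBl !mulmxBr opprB scalerDr !scalerBr.
rewrite big_split /= !sumrB -scaler_suml l1 scale1r.
have -> : \sum_i l i *: ((y i)^T *m y0) = y0^T *m y0.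
  rewrite -{2}ly linear_sum mulmx_suml; apply: eq_bigr => i _.
  by rewrite linearZ /= scalemxAl.
have -> : \sum_i l i *: (y0^T *m y i) = y0^T *m y0.
  rewrite -{3}ly mulmx_sumr; apply: eq_bigr => i _.
  by rewrite scalemxAr.
by rewrite subrr addr0.
Qed.

End Reflection.

(** * The eigenspace of the negative eigenvalues of [G] *)

Section Spectral.
Variables (R : realType) (n q : nat) (P Lam : 'M[R]_n) (sigma : 'I_q -> 'I_n).
Hypotheses (PP : P^T *m P = 1%:M) (Lamdiag : is_diag_mx Lam) (sigma_inj : injective sigma).
Hypothesis sigmaP : forall j : 'I_n, Lam j j < 0 <-> exists k, sigma k = j.

(** [N] is [P_-], with [sigma] enumerating the negative eigenvalues; [T] is the 0/1 matrix selecting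
    these columns, and [E] the diagonal projection onto them. *)
Let N := colsub sigma P.
Let T : 'M[R]_(n, q) := colsub sigma 1%:M.
Let E : 'M[R]_n := diag_mx (\row_j (Lam j j < 0)%R%:R).
Let lam : 'rV[R]_n := \row_j Lam j j.

Lemma diag_Lam : Lam = diag_mx lam.
Proof.
apply/matrixP => i j; rewrite !mxE; have [->|ij] := eqVneq i j; first by rewrite mulr1n.
by rewrite mulr0n; apply/(is_diag_mxP Lamdiag).
Qed.

Lemma colsub_mulmx : N = P *m T.
Proof. by rewrite mulmx_colsub mulmx1. Qed.

Lemma select_tr_mul : T^T *m T = 1%:M.
Proof.
apply/matrixP => i j; rewrite mxE (bigD1 (sigma i)) //= big1 => [|k ki].
  by rewrite !mxE eqxx mul1r addr0 (inj_eq sigma_inj).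
by rewrite !mxE (negPf ki) mul0r.
Qed.

Lemma select_mul_tr : T *m T^T = E.
Proof.
apply/matrixP => i j; rewrite !mxE.
have [[k kj]|nj] := pselect (exists k, sigma k = j).
  rewrite (bigD1 k) //= big1 => [|k' k'k].
    rewrite !mxE kj eqxx mulr1 addr0.
    have [->|_] := eqVneq i j; last by rewrite mulr0n.
    by have /sigmaP -> : exists k, sigma k = j by exists k.
  rewrite !mxE -kj [X in _ * X](_ : _ = 0) ?mulr0 //.
  by rewrite eq_sym (inj_eq sigma_inj) (negPf k'k).
rewrite big1 => [|k _].
  have [->|_] := eqVneq i j; last by rewrite mulr0n.
  by rewrite mulr1n; case: ltP => // /sigmaP.
rewrite !mxE [X in _ * X](_ : _ = 0) ?mulr0 //.
by case: eqP => // kj; case: nj; exists k.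
Qed.

Lemma colsub_orthonormal : N^T *m N = 1%:M.
Proof. by rewrite colsub_mulmx trmx_mul -mulmxA (mulmxA P^T) PP mul1mx select_tr_mul. Qed.

Lemma colsub_proj : N *m N^T = P *m E *m P^T.
Proof. by rewrite colsub_mulmx trmx_mul -!mulmxA (mulmxA T) select_mul_tr. Qed.

Lemma conj_mul (X Y : 'M[R]_n) :
  P *m X *m P^T *m (P *m Y *m P^T) = P *m (X *m Y) *m P^T.
Proof. by rewrite -!mulmxA (mulmxA P^T) PP mul1mx. Qed.

(** [N N^T = P E P^T] commutes with [P Lam P^T], since [E] and [Lam] are diagonal, and [N^T] absorbs
    this projection. *)
Lemma colsub_invariant : N^T *m (P *m Lam *m P^T) *m (1%:M - N *m N^T) = 0.
Proof.
rewrite mulmxBr mulmx1; apply/eqP; rewrite subr_eq0; apply/eqP.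
have -> : N *m N^T = P *m E *m P^T by exact: colsub_proj.
have NE : N^T *m (P *m E *m P^T) = N^T.
  by rewrite -colsub_proj mulmxA colsub_orthonormal mul1mx.
have LamE : Lam *m E = E *m Lam by rewrite diag_Lam diag_mxC.
by rewrite -(mulmxA N^T) conj_mul LamE -conj_mul (mulmxA N^T (P *m E *m P^T)) NE.
Qed.

(** In eigencoordinates the form is [sum lam_j (w T^T)_j^2], and [w T^T] is supported on the
    negative eigenvalues; a nonzero coordinate of [w] gives a strictly negative term. *)
Lemma colsub_neg (w : 'rV[R]_q) :
  w != 0 -> dot (w *m N^T *m (P *m Lam *m P^T) *m N) w < 0.
Proof.
move=> w0.
have -> : dot (w *m N^T *m (P *m Lam *m P^T) *m N) w
    = dot (w *m T^T *m diag_mx lam) (w *m T^T).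
  rewrite -diag_Lam colsub_mulmx !trmx_mul -!mulmxA !(mulmxA P^T) PP !mul1mx /dot.
  by rewrite trmx_mul trmxK !mulmxA.
rewrite dot_diag.
have wT k : (w *m T^T) 0 (sigma k) = w 0 k.
  rewrite mxE (bigD1 k) //= big1 => [|k' k'k]; rewrite !mxE.
    by rewrite eqxx mulr1 addr0.
  by rewrite eq_sym (inj_eq sigma_inj) (negPf k'k) mulr0.
have wT0 j : ~~ (Lam j j < 0) -> (w *m T^T) 0 j = 0.
  move=> jpos; rewrite mxE big1 // => k _; rewrite !mxE.
  case: eqP => [jk|_]; last by rewrite mulr0.
  by case/negP: jpos; apply/sigmaP; exists k.
have term j : lam 0 j * (w *m T^T) 0 j ^+ 2 <= 0.
  have [j0|/wT0->] := boolP (Lam j j < 0); last by rewrite expr0n /= mulr0.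
  by rewrite mxE nmulr_rle0 // sqr_ge0.
have [k wk] : exists k, w 0 k != 0.
  apply/existsP; apply: contraNT w0; rewrite negb_exists => /forallP w0.
  by apply/eqP/rowP => k; rewrite mxE; have := w0 k; rewrite negbK => /eqP.
rewrite (bigD1 (sigma k)) //= -[X in _ < X]addr0 ltr_leD //; last exact: sumr_le0.
have Ls : Lam (sigma k) (sigma k) < 0 by apply/sigmaP; exists k.
by rewrite wT mxE nmulr_rlt0 // lt0r sqrf_eq0 wk sqr_ge0.
Qed.

(** Both pairings are traces weighted by the [Lam i i], and [sign Lam] differs from [1 - 2 E] only
    where [Lam i i = 0]. *)
Lemma frob_reflection (L : R) :
  frob (P *m Lam *m P^T) (Hstar L P Lam)
    = L * frob (P *m Lam *m P^T) (1%:M - 2 *: (N *m N^T)).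
Proof.
have trPY (Y : 'M[R]_n) :
    \tr (P *m Lam *m P^T *m (P *m Y *m P^T)^T) = \sum_i Lam i i * Y i i.
  rewrite !trmx_mul trmxK (mulmxA P) conj_mul mxtrace_mulC (mulmxA P^T) PP mul1mx.
  apply: eq_bigr => i _; rewrite [in LHS]diag_Lam mul_diag_mx mxE.
  by rewrite [X in X * _]mxE [X in _ * X]mxE.
have PPt : P *m P^T = 1%:M by apply: mulmx1C.
rewrite !frobE /Hstar colsub_proj.
have -> : 1%:M - 2 *: (P *m E *m P^T) = P *m (1%:M - 2 *: E) *m P^T.
  by rewrite mulmxBr mulmxBl mulmx1 PPt -scalemxAr -scalemxAl.
rewrite linearZ /= -scalemxAr linearZ /= !trPY; congr (_ * _).
apply: eq_bigr => i _; rewrite !mxE eqxx !mulr1n.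
case: sgrP => [->|_|_]; first by rewrite !mul0r.
  by rewrite mulr0 subr0.
by congr (_ * _); rewrite mulr1; ring.
Qed.

End Spectral.

(** * From the barycentric data to the two-sided error bound *)

Lemma interpolation_error_le (R : realType) (n : nat) (L : R) (f : 'rV[R]_n -> R)
    (y : 'I_n.+1 -> 'rV[R]_n) (y0 : 'rV[R]_n) (l : 'I_n.+1 -> R)
    (P Lam : 'M[R]_n) (sigma : 'I_(nneg l) -> 'I_n) :
  0 < L -> C11 L f ->
  \sum_i l i = 1 -> \sum_i l i *: y i = y0 ->
  (forall i j : 'I_n.+1, (i <= j)%N -> l j <= l i) ->
  P^T *m P = 1%:M -> is_diag_mx Lam -> Gmat y0 y l = P *m Lam *m P^T ->
  injective sigma -> (forall j : 'I_n, Lam j j < 0 <-> exists k, sigma k = j) ->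
  (forall i k, 0 <= Mmat y0 y (colsub sigma P) i k) ->
  (forall i, 0 <= mu0 y0 y (colsub sigma P) i) ->
  \sum_i l i * f (y i) - f y0 <= 2^-1 * frob (Gmat y0 y l) (Hstar L P Lam).
Proof.
move=> L0 fL l1 ly lsort PP Ldiag GE sinj sP M0 m0.
set N := colsub sigma P in M0 m0.
pose neg (k : 'I_(nneg l)) : 'I_n.+1 := inord (n.+1 - nneg l + k).
pose a : 'rV[R]_(npos l) := \row_i l (inord i).
pose b : 'rV[R]_(nneg l) := \row_k l (neg k).
pose A := Yplus y0 y l; pose B := Yminus y0 y l.
have rowA i : row i A = y (inord i) - y0 by apply/rowP => j; rewrite !mxE.
have rowB k : row k B = y (neg k) - y0 by apply/rowP => j; rewrite !mxE.
have split (V : nmodType) (F : 'I_n.+1 -> V) : (forall i, l i = 0 -> F i = 0) ->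
    \sum_i F i = \sum_i F (inord (i : 'I_(npos l))) + \sum_k F (neg k).
  exact: sum_npos_nneg.
have split_fun (h : 'rV[R]_n -> R) : \sum_i l i * h (y i)
    = \sum_i a 0 i * h (y0 + row i A) + \sum_k b 0 k * h (y0 + row k B).
  rewrite split => [|i ->]; last by rewrite mul0r.
  by congr (_ + _); apply: eq_bigr => i _; rewrite !mxE ?rowA ?rowB addrC subrK.
have a0 i : 0 <= a 0 i.
  have pn : (npos l <= n.+1)%N by rewrite -[X in (_ <= X)%N]card_ord max_card.
  have il : (i < n.+1)%N := leq_trans (ltn_ord i) pn.
  by rewrite mxE ltW // -(lt_npos lsort) inordK.
have rows (k : nat) (d : 'rV[R]_k) (X : 'M[R]_(k, n)) :
    X^T *m diag_mx d *m X = \sum_i d 0 i *: ((row i X)^T *m row i X).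
  apply/matrixP => i j; rewrite mul_mx_diag summxE mxE; apply: eq_bigr => r _.
  by rewrite !mxE big_ord1 !mxE mulrCA mulrA.
have GAB : Gmat y0 y l = A^T *m diag_mx a *m A + B^T *m diag_mx b *m B.
  rewrite Gmat_centered // !rows split => [|i ->]; last by rewrite scale0r.
  by congr (_ + _); apply: eq_bigr => i _; rewrite mxE ?rowA ?rowB.
have aAbB : a *m A + b *m B = 0.
  transitivity (\sum_i l i *: (y i - y0)).
    rewrite split => [|i ->]; last by rewrite scale0r.
    by rewrite !mulmx_sum_row; congr (_ + _);
      apply: eq_bigr => i _; rewrite mxE ?rowA ?rowB.
  under eq_bigr do rewrite scalerBr.
  by rewrite sumrB ly -scaler_suml l1 scale1r subrr.
have ab1 : \sum_i a 0 i + \sum_k b 0 k = 1.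
  rewrite -l1 split //.
  by congr (_ + _); apply: eq_bigr => i _; rewrite mxE.
have NN := colsub_orthonormal PP sinj; rewrite -/N in NN.
have S_sym : (1%:M - 2 *: (N *m N^T))^T = 1%:M - 2 *: (N *m N^T).
  by rewrite linearB /= trmx1 linearZ /= trmx_mul trmxK.
(* Replacing [H*] by [L (1 - 2 N N^T)] turns the right-hand side into the weighted sum of the
   quadratic form [phi] over all points. *)
rewrite GE (frob_reflection PP Ldiag sinj sP L) -GE frob_Gmat //.
rewrite mulrA (mulrC _ L) split_fun.
rewrite (split_fun (fun x => dot x (x *m (1%:M - 2 *: (N *m N^T))))).
apply: weighted_bound => //.
- by rewrite -GAB GE; exact: colsub_neg.
- by rewrite -GAB GE; exact: colsub_invariant.
- by move=> i; have := m0 i; rewrite /mu0 [a 0 i]mxE.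
Qed.

Theorem theorem4p5 (R : realType) (n : nat) (L : R) (f : 'rV[R]_n -> R)
    (y : 'I_n.+1 -> 'rV[R]_n) (y0 : 'rV[R]_n) (m : 'rV[R]_n -> R)
    (l : 'I_n.+1 -> R) (P Lam : 'M[R]_n) (sigma : 'I_(nneg l) -> 'I_n) :
  (1 <= n)%N -> 0 < L -> C11 L f ->
  aff_indep y ->
  is_affine m -> (forall i, m (y i) = f (y i)) ->
  \sum_i l i = 1 -> \sum_i l i *: y i = y0 ->
  (forall i j : 'I_n.+1, (i <= j)%N -> l j <= l i) ->
  P^T *m P = 1%:M -> is_diag_mx Lam -> Gmat y0 y l = P *m Lam *m P^T ->
  injective sigma -> (forall j : 'I_n, Lam j j < 0 <-> exists k, sigma k = j) ->
  (forall i k, 0 <= Mmat y0 y (colsub sigma P) i k) ->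
  (forall i, 0 <= mu0 y0 y (colsub sigma P) i) ->
  `|m y0 - f y0| <= 2^-1 * frob (Gmat y0 y l) (Hstar L P Lam).
Proof.
move=> _ L0 fL _ [c [d mE]] my l1 ly lsort PP Ldiag GE sinj sP M0 m0.
(* An affine function commutes with combinations whose weights sum to 1. *)
have -> : m y0 = \sum_i l i * f (y i).
  under eq_bigr do rewrite -my mE -dotE mulrDr -dotZr.
  by rewrite big_split /= -dot_sumr ly -mulr_suml l1 mul1r mE dotE.
rewrite ler_norml -lerN2 opprK; apply/andP; split.
  (* The lower bound is the upper bound for [- f]; the weights and [G] do not depend on [f]. *)
  apply: le_trans (interpolation_error_le L0 (C11N fL) l1 ly lsort PP Ldiag GE sinj sP M0 m0).
  by under [X in _ <= X - _]eq_bigr do rewrite mulrN; rewrite sumrN opprB opprK addrC.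
exact: (interpolation_error_le L0 fL l1 ly lsort PP Ldiag GE sinj sP M0 m0).
Qed.
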